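(* Let $\bar t\in(0,\tfrac12)$, $B>0$, $\varepsilon\in(0,\bar t)$, and $F\in\mathcal{F}_{\bar t,B}$. Let the pairs $(Y_i,D_i)$, for $i\in[n]$, be drawn independently (across $i$) with marginals $Y_i\sim F$ and $D_i\sim\mathrm{Ber}(\varepsilon)$ ($Y_i$ and $D_i$ need not be independent of each other). Let $\{Z_i\}_{i\in[n]}$ be arbitrary random variables possibly depending on $\{Y_i,D_i\}_{i\in[n]}$, and define $X_i=(1-D_i)Y_i+D_iZ_i$. Then, for any confidence level $\delta\in(0,1)$, any error level $E>0$, and any number of samples $n\ge 2\max\left(\tfrac{B^2m_2(F)^2}{E^2},(\bar t-\varepsilon)^{-2}\right)\log\tfrac3\delta$, $$\mathbb{P}\Big(\left|\hat m_1(X_1,\dots,X_n)-m_1(F)\right|\le B\,m_2(F)\,\varepsilon+E\Big)\ge 1-\delta .$$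
   Context: Distributions are on $\mathbb{R}$ and identified with their cdfs; $[n]=\{1,\dots,n\}$. For a cdf $F$, $Q_{L,F}(p)=\inf\{x:F(x)\ge p\}$ and $Q_{R,F}(p)=\inf\{x:F(x)>p\}$. The median of $F$ is $m_1(F)$ (when unique), and the median absolute deviation (MAD) is $m_2(F):=$ the median of $|X-m_1(F)|$ with $X\sim F$. The empirical median $\hat m_1(x_1,\dots,x_n)$ is the middle value if $n$ is odd and the average of the two middle values if $n$ is even. For $\bar t\in(0,\tfrac12)$ and $B>0$, $\mathcal{F}_{\bar t,B}$ is the family of distributions $F$ that have a unique median and satisfy $$|F(x_1)-F(x_2)|\ge\frac{1}{B\,m_2(F)}|x_1-x_2|\quad\text{for all }x_1,x_2\in\left[Q_{L,F}(\tfrac12-\bar t),\,Q_{R,F}(\tfrac12+\bar t)\right].$$ *)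

(* Defs.v *)
From HB Require Import structures.
From mathcomp Require Import all_boot all_order all_algebra.
From mathcomp Require Import all_classical all_reals all_analysis.

Set Implicit Arguments.
Unset Strict Implicit.
Unset Printing Implicit Defensive.

Import Order.TTheory GRing.Theory Num.Theory.
Import numFieldNormedType.Exports.

Local Open Scope classical_set_scope.
Local Open Scope ring_scope.

(* Laws are compared on measurable sets only: the value of a [probability] on
   a non-measurable set is unconstrained. *)
Definition has_law d d' (T : measurableType d) (T' : measurableType d')
    (R : realType) (P : probability T R) (X : {RV P >-> T'})
    (mu : set T' -> \bar R) : Prop :=
  forall A : set T', measurable A -> distribution P X A = mu A.

Definition mutually_independent d d' (T : measurableType d)
    (T' : measurableType d') (R : realType) (P : probability T R) (I : finType)
    (W : I -> T -> T') : Prop :=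
  forall (J : {set I}) (A : I -> set T'),
    (forall i, i \in J -> measurable (A i)) ->
    P (\bigcap_(i in [set` J]) W i @^-1` A i) =
    (\prod_(i in J) P (W i @^-1` A i))%E.

(* The distribution function of a law on the line; the library's [cdf] is that
   of a random variable. *)
Definition law_cdf (R : realType) (F : probability R R) (x : R) : R :=
  fine (F `]-oo, x]%classic).

Definition left_quantile (R : realType) (F : probability R R) (p : R) : R :=
  inf [set x | p <= law_cdf F x].

Definition right_quantile (R : realType) (F : probability R R) (p : R) : R :=
  inf [set x | p < law_cdf F x].

Definition is_median (R : realType) (mu : set R -> \bar R) (m : R) : Prop :=
  ((2^-1)%:E <= mu `]-oo, m]%classic)%E /\ ((2^-1)%:E <= mu `[m, +oo[%classic)%E.

(* [m2] is a median of |X - m1| for X distributed as [F]. *)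
Definition is_mad (R : realType) (F : probability R R) (m1 m2 : R) : Prop :=
  is_median (pushforward F (fun x : R => `|x - m1|)) m2.

(* [m2] stands for the median absolute deviation of [F]; it is a parameter
   because uniqueness of the median of [F] does not make the median of
   |X - m1| unique.  The inverse is the extended-real one, so for [m2 = 0] the
   slope is [+oo] (and [+oo * 0 = 0]): the bound then forces the interval to be
   a single point, whereas the inverse of [R] would make it vacuous. *)
Definition median_family (R : realType) (tbar B m2 : R)
    (F : probability R R) : Prop :=
  (exists! m, is_median F m) /\
  forall x1 x2 : R,
    x1 \in `[left_quantile F (2^-1 - tbar), right_quantile F (2^-1 + tbar)] ->
    x2 \in `[left_quantile F (2^-1 - tbar), right_quantile F (2^-1 + tbar)] ->
    (((B * m2)%:E)^-1 * `|x1 - x2|%:E <= `|law_cdf F x1 - law_cdf F x2|%:E)%E.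

Definition empirical_median (R : realType) (n : nat) (x : 'I_n -> R) : R :=
  let s := sort <=%R (codom x) in
  if odd n then s`_(n./2) else (s`_(n./2.-1) + s`_(n./2)) / 2.

Definition contaminated (R : realType) (T : Type) (n : nat)
    (Y : 'I_n -> T -> R) (D : 'I_n -> T -> bool) (Z : 'I_n -> T -> R)
    (i : 'I_n) (w : T) : R :=
  (1 - (D i w)%:R) * Y i w + (D i w)%:R * Z i w.

(* Main.v *)
(* An observation that differs from Y_i requires D_i = 1, so with
   r = B m2 eps + E the empirical median exceeds m1 + r only if at least half
   of the independent events {Y_i > m1 + r or D_i = 1} occur.  The slope
   condition bounds the probability of each by 1/2 - s for some s > 0 with
   n s^2 >= 2 log (3/delta), whatever the coupling of Y_i and D_i.  An
   exponential-moment bound with base 1 + 2s makes the majority event have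
   probability at most (1 - 2 s^2)^n <= delta/3; the lower side is similar. *)
Require Import Defs.
From HB Require Import structures.
From mathcomp Require Import all_boot all_order all_algebra.
From mathcomp Require Import all_classical all_reals all_analysis.
From mathcomp Require Import measurable_realfun ring lra zify.

Set Implicit Arguments.
Unset Strict Implicit.
Unset Printing Implicit Defensive.

Import Order.TTheory GRing.Theory Num.Theory.
Import numFieldNormedType.Exports.

Local Open Scope classical_set_scope.
Local Open Scope ring_scope.

(** * Order statistics and the empirical median *)

Lemma size_sort_codom (R : realType) (n : nat) (x : 'I_n -> R) :
  size (sort <=%R (codom x)) = n.
Proof. by rewrite size_sort size_codom card_ord. Qed.

Lemma count_sort_codom (R : realType) (n : nat) (x : 'I_n -> R) (p : pred R) :
  count p (sort <=%R (codom x)) = #|[pred i | p (x i)]|.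
Proof.
by rewrite count_sort /codom /image_mem count_map -size_filter enumT cardE.
Qed.

Lemma le_order_stat (R : realType) (n : nat) (x : 'I_n -> R) (i j : nat) :
  (i <= j)%N -> (j < n)%N ->
  (sort <=%R (codom x))`_i <= (sort <=%R (codom x))`_j.
Proof.
move=> ij jn; apply: (sorted_leq_nth le_trans lexx) => //.
- exact/sort_sorted/le_total.
- by rewrite inE size_sort_codom (leq_ltn_trans ij).
- by rewrite inE size_sort_codom.
Qed.

(** In the sorted list, an entry at index [k] that is at most [a] brings the first [k.+1] entries
    below [a] with it; one that exceeds [a] leaves only the first [k] entries as candidates. *)
Lemma order_stat_le (R : realType) (n : nat) (x : 'I_n -> R) (k : nat) (a : R) :
  (k < n)%N ->
  ((sort <=%R (codom x))`_k <= a) = (k < #|[pred i | (x i <= a)%R]|)%N.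
Proof.
move=> kn; rewrite -(count_sort_codom x (fun y => y <= a)).
set s := sort _ _; have sz : size s = n := size_sort_codom x.
apply/idP/idP => [sk|].
  rewrite -(cat_take_drop k.+1 s) count_cat.
  have /eqP -> : count (fun y => y <= a) (take k.+1 s) == size (take k.+1 s).
    rewrite -all_count; apply/(all_nthP 0) => i.
    rewrite size_takel ?sz// => ik; rewrite nth_take//.
    apply: le_trans sk; exact: le_order_stat kn.
  by rewrite size_takel ?sz// ltn_addr.
apply: contraLR; rewrite -ltNge -leqNgt => sk.
rewrite -(cat_take_drop k s) count_cat.
have -> : count (fun y => y <= a) (drop k s) = 0%N.
  apply/eqP; rewrite -leqn0 leqNgt -has_count; apply/negP => /(has_nthP 0)[i].
  rewrite size_drop sz nth_drop => ik; rewrite leNgt => /negP; apply.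
  apply: lt_le_trans sk (le_order_stat x (leq_addr _ _) _).
  by rewrite -ltn_subRL.
by rewrite addn0 (leq_trans (count_size _ _))// size_takel// sz ltnW.
Qed.

(** It suffices to bound the upper middle value, of index [n./2], since for even [n] the other one
    is no larger. *)
Lemma empirical_median_le (R : realType) (n : nat) (x : 'I_n -> R) (a : R) :
  (2 * #|[pred i | (a < x i)%R]| < n)%N -> empirical_median x <= a.
Proof.
move=> few.
have n0 : (0 < n)%N by exact: leq_ltn_trans few.
have kn : (n./2 < n)%N by rewrite -divn2 ltn_Pdiv.
have sk : (sort <=%R (codom x))`_(n./2) <= a.
  rewrite order_stat_le//.
  have := cardC [pred i | (a < x i)%R]; rewrite card_ord.
  have -> : #|predC [pred i | (a < x i)%R]| = #|[pred i | (x i <= a)%R]|.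
    by apply: eq_card => i; rewrite !inE/= -leNgt.
  move: few (odd_double_half n); rewrite -muln2.
  move: #|_| #|_| => c c'; case: (odd n); lia.
rewrite /empirical_median; case: ifP => // _.
rewrite ler_pdivrMr// mulr_natr mulr2n lerD//.
by apply: le_trans sk; exact: le_order_stat (leq_pred _) kn.
Qed.

Lemma empirical_median_ge (R : realType) (n : nat) (x : 'I_n -> R) (a : R) :
  (2 * #|[pred i | (x i < a)%R]| < n)%N -> a <= empirical_median x.
Proof.
move=> few.
have n0 : (0 < n)%N by exact: leq_ltn_trans few.
have kn : (n./2 < n)%N by rewrite -divn2 ltn_Pdiv.
(* Stated for a general index because the lower middle value, of index [n./2.-1], is the critical
   one when [n] is even. *)
have sge k : (2 * #|[pred i | (x i < a)%R]| < 2 * k.+1)%N -> (k < n)%N ->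
    a <= (sort <=%R (codom x))`_k.
  move=> fewk kn'; rewrite leNgt; apply/negP => ska.
  suff : (k < #|[pred i | (x i < a)%R]|)%N by lia.
  (* The counting criterion at the level [s_k] itself: more than [k] observations are at most [s_k],
     hence below [a]. *)
  have := order_stat_le x ((sort <=%R (codom x))`_k) kn'.
  rewrite lexx => /esym/leq_trans; apply.
  apply: subset_leq_card; apply/fintype.subsetP => i.
  by rewrite !inE => /le_lt_trans; apply.
have := odd_double_half n; rewrite -muln2 /empirical_median.
case: (odd n) => /= nE; first by apply: sge => //; lia.
rewrite ler_pdivlMr// mulr_natr mulr2n lerD//; apply: sge; lia.
Qed.

(** * The random set of indices whose event occurs *)

Definition hits (T : Type) (I : finType) (G : I -> set T) (w : T) : {set I} :=
  finset (fun i => `[< G i w >]).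

(** These are the atoms generated by the events [G i]. Any event on [hits G] is a finite disjoint
    union of them, and independence turns the probability of each into a product. *)
Lemma preimage_hits1 (T : Type) (I : finType) (G : I -> set T) (J : {set I}) :
  hits G @^-1` [set J] =
  \bigcap_(i in [set: I]) (if i \in J then G i else ~` G i).
Proof.
apply/seteqP; split=> w /=.
  move=> <- i _; rewrite inE; case: ifPn => [/asboolP//|/asboolPn//].
move=> GJ; apply/setP => i; rewrite inE.
have := GJ i Logic.I; case: ifPn => _ Gi; first exact/asboolP.
exact/asboolPn.
Qed.

Lemma measurable_hits1 d (T : measurableType d) (I : finType) (G : I -> set T)
  (J : {set I}) : (forall i, measurable (G i)) ->
  measurable (hits G @^-1` [set J]).
Proof.
move=> mG; rewrite preimage_hits1; apply: fin_bigcap_measurable => // i _.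
by case: ifP => _; [exact: mG|exact/measurableC/mG].
Qed.

Lemma preimage_hits_bigcup (T : Type) (I : finType) (G : I -> set T)
    (Q : set {set I}) :
  hits G @^-1` Q = \bigcup_(J in Q) (hits G @^-1` [set J]).
Proof.
apply/seteqP; split=> [w Qw|w [J QJ hJ]]; first by exists (hits G w).
by rewrite /preimage/= hJ.
Qed.

Lemma measurable_hits d (T : measurableType d) (I : finType) (G : I -> set T)
  (Q : set {set I}) : (forall i, measurable (G i)) ->
  measurable (hits G @^-1` Q).
Proof.
move=> mG; rewrite preimage_hits_bigcup; apply: fin_bigcup_measurable => //.
by move=> J _; exact: measurable_hits1.
Qed.

(** * Exponential bound for a majority of independent events *)

Lemma prodEFin (R : realType) (I : finType) (f : I -> R) :
  (\prod_i (f i)%:E = (\prod_i f i)%:E)%E.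
Proof. by rewrite (big_morph EFin EFinM (erefl _)). Qed.

(* Markov's inequality for v ^ (2 #|J| - #|I|), written as a finite sum:
   the base v = 1 + 2s gives (1/2 - s) v + (1/2 + s) / v = 1 - 2 s^2 exactly. *)
Lemma majority_tail (R : realType) (I : finType) (p : I -> R) (s : R) :
  0 <= s <= 2^-1 -> (forall i, 0 <= p i <= 2^-1 - s) ->
  \sum_(J : {set I} | (#|I| <= 2 * #|J|)%N)
    \prod_i (if i \in J then p i else 1 - p i) <= (1 - 2 * s ^+ 2) ^+ #|I|.
Proof.
move=> /andP[s0 s12] hp; pose v := 1 + 2 * s.
have v1 : 1 <= v by rewrite /v; lra.
have v0 : 0 < v by lra.
have p1 i : 0 <= 1 - p i by have := hp i; lra.
have p0 i : 0 <= p i by have := hp i; lra.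
apply: (@le_trans _ _ (\sum_(J : {set I})
    \prod_i (if i \in J then p i * v else (1 - p i) / v))).
  rewrite [leLHS]big_mkcond /=; apply: ler_sum => J _; case: ifPn => [hJ|_].
    have -> : \prod_i (if i \in J then p i * v else (1 - p i) / v) =
        (\prod_i (if i \in J then p i else 1 - p i)) *
        \prod_i (if i \in J then v else v^-1).
      by rewrite -big_split/=; apply: eq_bigr => i _; case: ifP.
    (* The extra factor is [v] to the power [#|J|] minus the size of the complement, which is at
       least 1 when [J] contains at least half of the indices. *)
    rewrite ler_peMr//.
      by apply: prodr_ge0 => i _; case: ifP.
    rewrite big_if/= !prodr_const exprVn.
    rewrite ler_pdivlMr ?exprn_gt0// mul1r.
    rewrite ler_weXn2l//.
    have := cardC J; move: hJ.
    rewrite (eq_card (A := fun i => ~~ _) (B := [predC J]))//.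
    by move=> + JI; rewrite -JI mul2n -addnn leq_add2l.
  by apply: prodr_ge0 => i _; case: ifP => _; rewrite mulr_ge0 ?invr_ge0// ltW.
(* Without the majority restriction the sum over subsets factors into one term
   [p i * v + (1 - p i) / v] per index. *)
rewrite -bigA_distr /=.
rewrite -prodr_const; apply: ler_prod => i _; apply/andP; split.
  by rewrite addr_ge0// mulr_ge0 ?invr_ge0// ltW.
have /andP[_ hpi] := hp i.
have -> : 1 - 2 * s ^+ 2 = (2^-1 - s) * v + (1 - (2^-1 - s)) / v.
  by rewrite /v; field; lra.
rewrite -subr_ge0.
(* The one-index term is affine in [p i] with slope [v - v^-1 >= 0], so it is largest at
   [p i = 2^-1 - s]. *)
have -> : (2^-1 - s) * v + (1 - (2^-1 - s)) / v - (p i * v + (1 - p i) / v) =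
   (2^-1 - s - p i) * (v - v^-1) by field; lra.
rewrite mulr_ge0//; first lra.
by rewrite subr_ge0 (le_trans _ v1)// invf_le1.
Qed.

Lemma hits_majority_prob d (T : measurableType d) (R : realType)
    (P : probability T R) (I : finType) (G : I -> set T) (s : R) :
  (forall i, measurable (G i)) ->
  (forall J : {set I},
     P (\bigcap_(i in [set: I]) (if i \in J then G i else ~` G i)) =
     (\prod_i P (if i \in J then G i else ~` G i))%E) ->
  0 <= s <= 2^-1 -> (forall i, (P (G i) <= (2^-1 - s)%:E)%E) ->
  (P [set w | (#|I| <= 2 * #|hits G w|)%N] <=
   ((1 - 2 * s ^+ 2) ^+ #|I|)%:E)%E.
Proof.
move=> mG indep s01 hG.
rewrite -[X in P X]/(hits G @^-1` [set J : {set I} | (#|I| <= 2 * #|J|)%N]).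
rewrite preimage_hits_bigcup measure_fin_bigcup; first last.
- by move=> J _; exact: measurable_hits1.
- exact: trivIset_preimage1.
- exact: finite_finset.
have PG i : P (G i) = (fine (P (G i)))%:E by rewrite fineK// fin_num_measure.
pose p i := fine (P (G i)).
have hJ J : P (hits G @^-1` [set J]) =
    (\prod_i (if i \in J then p i else 1 - p i))%:E.
  rewrite preimage_hits1 indep -prodEFin; apply: eq_bigr => i _.
  by case: ifP => _; rewrite ?probability_setC// PG.
rewrite (_ : [set J | _] =
    [set` enum [pred J : {set I} | (#|I| <= 2 * #|J|)%N]]); last first.
  by apply/seteqP; split=> J /=; rewrite mem_enum.
rewrite -fsbig_seq ?enum_uniq// big_enum/=.
under eq_bigr do rewrite hJ.
rewrite sumEFin lee_fin.
apply: le_trans (majority_tail (p := p) s01 _) => // i.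
by rewrite /p fine_ge0//= -lee_fin -PG hG.
Qed.

(** * Distribution function, quantiles and medians of a law *)

Lemma law_cdfE (R : realType) (F : probability R R) (x : R) :
  (law_cdf F x)%:E = F `]-oo, x]%classic.
Proof. by rewrite /law_cdf fineK// fin_num_measure. Qed.

Lemma law_cdf_nondecreasing (R : realType) (F : probability R R) (x y : R) :
  x <= y -> law_cdf F x <= law_cdf F y.
Proof.
by move=> xy; rewrite -lee_fin !law_cdfE le_measure ?inE//; exact: subitvPr.
Qed.

Lemma law_cdf_lt_near_Ny (R : realType) (F : probability R R) (p : R) :
  0 < p -> exists x, law_cdf F x < p.
Proof.
move=> p0.
(* The identity, as a random variable under [F], has distribution function [law_cdf F], so the
   limits known for [cdf] apply. *)
have mid : measurable_fun [set: R] (@idfun R) by exact: measurable_id.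
pose X : {RV F >-> R} :=
  HB.pack (@idfun R) (isMeasurableFun.Build _ _ _ _ _ mid).
have XE x : cdf X x = (law_cdf F x)%:E by rewrite law_cdfE.
have /fine_cvgP[_ /cvgr_lt/(_ _ p0)[M [_ hM]]] := cvg_cdfNy0 X.
exists (M - 1); have := hM (M - 1); rewrite /= XE; apply.
by rewrite ltrBlDr ltrDl.
Qed.

Lemma law_cdf_gt_near_y (R : realType) (F : probability R R) (p : R) :
  p < 1 -> exists x, p < law_cdf F x.
Proof.
move=> p1.
have mid : measurable_fun [set: R] (@idfun R) by exact: measurable_id.
pose X : {RV F >-> R} :=
  HB.pack (@idfun R) (isMeasurableFun.Build _ _ _ _ _ mid).
have XE x : cdf X x = (law_cdf F x)%:E by rewrite law_cdfE.
have /fine_cvgP[_ /cvgr_gt/(_ _ p1)[M [_ hM]]] := cvg_cdfy1 X.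
exists (M + 1); have := hM (M + 1); rewrite /= XE; apply.
by rewrite ltrDl.
Qed.

Lemma left_quantile_le (R : realType) (F : probability R R) (p x : R) :
  0 < p -> p <= law_cdf F x -> left_quantile F p <= x.
Proof.
move=> p0 px; apply: ge_inf => //=.
(* As [0 < p], the set is bounded below, so [inf] is a genuine infimum and not its default value
   0. *)
have [y yp] := law_cdf_lt_near_Ny F p0.
exists y => z /= pz; rewrite leNgt; apply/negP => zy.
by have := law_cdf_nondecreasing F (ltW zy); lra.
Qed.

Lemma law_cdf_lt_left_quantile (R : realType) (F : probability R R) (p x : R) :
  0 < p -> x < left_quantile F p -> law_cdf F x < p.
Proof.
move=> p0 xq; rewrite ltNge; apply/negP => /(left_quantile_le p0).
by rewrite leNgt xq.
Qed.

Lemma le_right_quantile (R : realType) (F : probability R R) (p x : R) :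
  p < 1 -> (forall y, y < x -> law_cdf F y <= p) -> x <= right_quantile F p.
Proof.
move=> p1 hx; apply: lb_le_inf.
  (* As [p < 1], the set is nonempty; [inf] of the empty set would be 0. *)
  by have [y py] := law_cdf_gt_near_y F p1; exists y.
move=> y /= py; rewrite leNgt; apply/negP => /hx; lra.
Qed.

Lemma right_quantile_lt_law_cdf (R : realType) (F : probability R R) (p x : R) :
  p < 1 -> right_quantile F p < x -> p < law_cdf F x.
Proof.
move=> p1 /inf_lt[|y /= py yx].
  by have [y py] := law_cdf_gt_near_y F p1; exists y.
exact: lt_le_trans py (law_cdf_nondecreasing F (ltW yx)).
Qed.

Lemma is_median_law_cdf (R : realType) (F : probability R R) (m : R) :
  is_median F m ->
  2^-1 <= law_cdf F m /\ forall x, x < m -> law_cdf F x <= 2^-1.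
Proof.
move=> [m1 m2]; split=> [|x xm]; first by rewrite -lee_fin law_cdfE.
rewrite -lee_fin law_cdfE.
have : (F `]-oo, x]%classic <= F (~` `[m, +oo[%classic))%E.
  rewrite le_measure ?inE//; first exact: measurableC.
  move=> y /=; rewrite !in_itv/= andbT => yx; apply/negP.
  by rewrite -ltNge (le_lt_trans yx).
rewrite probability_setC// => /le_trans; apply.
move: m2; rewrite -(@fineK _ (F `[m, +oo[%classic)) ?fin_num_measure//.
rewrite -EFinB !lee_fin; lra.
Qed.

(** * Tail masses from the slope condition *)

Lemma is_mad_ge0 (R : realType) (F : probability R R) (m1 m2 : R) :
  is_mad F m1 m2 -> 0 <= m2.
Proof.
move=> [h _]; rewrite leNgt; apply/negP => m20; move: h.
rewrite /pushforward (_ : _ @^-1` _ = set0) ?measure0 ?lee_fin.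
  by rewrite leNgt invr_gt0 ltr0n.
apply/seteqP; split=> // y /=; rewrite in_itv/= => ym.
by have := normr_ge0 (y - m1); rewrite leNgt (le_lt_trans ym).
Qed.

(** Clearing the denominator gives a real inequality that also covers [B * m2 = 0]. *)
Lemma median_family_increment (R : realType) (tbar B m2 : R)
    (F : probability R R) (x y : R) :
  0 <= B * m2 -> median_family tbar B m2 F -> x <= y ->
  left_quantile F (2^-1 - tbar) <= x -> y <= right_quantile F (2^-1 + tbar) ->
  y - x <= B * m2 * (law_cdf F y - law_cdf F x).
Proof.
move=> c0 [_ hF] xy lx yr.
have := hF y x; rewrite !in_itv/= yr lx (le_trans lx xy) (le_trans xy yr).
move=> /(_ isT isT); rewrite ger0_norm ?subr_ge0//.
rewrite (@ger0_norm _ (_ - law_cdf F x)); last first.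
  by rewrite subr_ge0 law_cdf_nondecreasing.
rewrite inver; case: eqP => [-> | /eqP c_neq0]; last first.
  rewrite -EFinM lee_fin mulrC ler_pdivrMr ?lt_neqAle 1?eq_sym ?c_neq0//.
  by rewrite [leRHS]mulrC.
(* Here the slope is [+oo]: a positive length would make a finite increment of the cdf infinite, so
   [y = x]. *)
rewrite mul0r; have [->|yx] := eqVneq (y - x) 0; first by [].
by rewrite gt0_mulye ?lte_fin ?lt_neqAle 1?eq_sym ?yx ?subr_ge0// leye_eq.
Qed.

(** Beyond the right quantile the cdf already exceeds [2^-1 + tbar], which is at least
    [2^-1 + eps + s]. Otherwise [m1] and [t] both lie in the interval of the slope condition, and
    the cdf grows by at least [eps + s] from a value of at least 1/2. *)
Lemma upper_tail_mass (R : realType) (tbar B eps : R) (F : probability R R)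
    (m1 m2 s t : R) :
  0 < tbar < 2^-1 -> 0 <= B * m2 ->
  is_median F m1 -> median_family tbar B m2 F ->
  0 < eps -> s <= tbar - eps -> m1 < t -> B * m2 * (eps + s) <= t - m1 ->
  2^-1 + eps + s <= law_cdf F t.
Proof.
move=> /andP[tb0 tb1] c0 hm hF e0 st m1t hc.
have [Fm Fx] := is_median_law_cdf hm.
have [tr|rt] := leP t (right_quantile F (2^-1 + tbar)); last first.
  have := @right_quantile_lt_law_cdf _ F (2^-1 + tbar) t; rewrite rt; lra.
have lm : left_quantile F (2^-1 - tbar) <= m1 by apply: left_quantile_le; lra.
have := median_family_increment c0 hF (ltW m1t) lm tr => inc.
suff : eps + s <= law_cdf F t - law_cdf F m1 by lra.
(* A zero scale would collapse the interval to a point, against [m1 < t]. *)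
have c1 : 0 < B * m2.
  rewrite lt_neqAle c0 andbT eq_sym; apply/eqP => c00.
  by move: inc; rewrite c00 mul0r; lra.
by rewrite -(ler_pM2l c1); lra.
Qed.

Lemma lower_tail_mass (R : realType) (tbar B eps : R) (F : probability R R)
    (m1 m2 s t : R) :
  0 < tbar < 2^-1 -> 0 <= B * m2 ->
  is_median F m1 -> median_family tbar B m2 F ->
  0 < eps -> s <= tbar - eps -> t < m1 -> B * m2 * (eps + s) <= m1 - t ->
  law_cdf F t <= 2^-1 - eps - s.
Proof.
move=> /andP[tb0 tb1] c0 hm hF e0 st tm1 hc.
have [Fm Fx] := is_median_law_cdf hm.
have [lt|tl] := leP (left_quantile F (2^-1 - tbar)) t; last first.
  have := @law_cdf_lt_left_quantile _ F (2^-1 - tbar) t; rewrite tl; lra.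
have mr : m1 <= right_quantile F (2^-1 + tbar).
  by apply: le_right_quantile => [|y /Fx]; lra.
(* [F] may jump at the median, so the slope bound is used at x < m1, x -> m1. *)
have inc x : t <= x < m1 -> x - t <= B * m2 * (2^-1 - law_cdf F t).
  move=> /andP[tx xm]; have := median_family_increment c0 hF tx lt.
  move=> /(_ (le_trans (ltW xm) mr)) /le_trans; apply.
  by rewrite ler_wpM2l// lerD2r Fx.
have {}inc : m1 - t <= B * m2 * (2^-1 - law_cdf F t).
  rewrite lerBlDr; apply/ler_addgt0Pl => e egt0.
  (* The point [m1 - e] is cut off at [t] so that it stays in the range of the slope bound. *)
  have := inc (Num.max t (m1 - e)); rewrite le_max lexx gt_max tm1.
  have : m1 - e <= Num.max t (m1 - e) by rewrite le_max lexx orbT.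
  rewrite ltrBlDr ltrDl egt0 => h /(_ isT); lra.
suff : eps + s <= 2^-1 - law_cdf F t by lra.
have c1 : 0 < B * m2.
  rewrite lt_neqAle c0 andbT eq_sym; apply/eqP => c00.
  by move: inc; rewrite c00 mul0r; lra.
by rewrite -(ler_pM2l c1); lra.
Qed.

(** * Measurability of the empirical median and of the observations *)

Lemma measurable_order_stat d (T : measurableType d) (R : realType) (n : nat)
    (X : 'I_n -> T -> R) (k : nat) :
  (forall i, measurable_fun setT (X i)) -> (k < n)%N ->
  measurable_fun setT (fun w => (sort <=%R (codom (X ^~ w)))`_k).
Proof.
move=> mX kn; apply: (measurability _ (RGenOInfty.measurableE R)).
move=> _ [_ [a ->] <-]; rewrite setTI.
pose G i := X i @^-1` `]-oo, a]%classic.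
(* The order statistic of index [k] exceeds [a] exactly when at most [k] observations are at most
   [a], an event on the random index set. *)
rewrite (_ : _ @^-1` _ =
    hits G @^-1` [set J : {set 'I_n} | ~ (k < #|J|)%N]); last first.
  have hitsE w : #|hits G w| = #|[pred i | X i w <= a]|.
    by apply: eq_card => i; rewrite !inE /G/= in_itv/= asboolb.
  apply/seteqP; split=> w /=.
    by rewrite in_itv/= andbT ltNge order_stat_le// hitsE => /negP.
  by rewrite in_itv/= andbT ltNge order_stat_le// hitsE => /negP.
apply: measurable_hits => i; rewrite -[X in measurable X]setTI.
exact: mX.
Qed.

Lemma measurable_empirical_median d (T : measurableType d) (R : realType)
    (n : nat) (X : 'I_n -> T -> R) :
  (0 < n)%N -> (forall i, measurable_fun setT (X i)) ->
  measurable_fun setT (fun w => empirical_median (X ^~ w)).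
Proof.
move=> n0 mX; have kn : (n./2 < n)%N by rewrite -divn2 ltn_Pdiv.
rewrite /empirical_median; case: (odd n) => /=.
  exact: measurable_order_stat.
apply: measurable_funM => //; apply: measurable_funD.
  by apply: measurable_order_stat => //; exact: leq_ltn_trans (leq_pred _) kn.
exact: measurable_order_stat.
Qed.

Lemma measurable_contaminated d (T : measurableType d) (R : realType) (n : nat)
    (P : probability T R) (Y : 'I_n -> {RV P >-> R})
    (D : 'I_n -> {RV P >-> bool}) (Z : 'I_n -> {RV P >-> R}) (i : 'I_n) :
  measurable_fun setT (contaminated Y D Z i).
Proof.
have mD : measurable_fun setT (fun w => (D i w)%:R : R).
  by apply: (measurableT_comp (f := fun b : bool => b%:R : R)).
apply: measurable_funD; apply: measurable_funM => //.
exact: measurable_funB.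
Qed.

(** * Tail bound under contamination *)

Lemma contamination_tail d (T : measurableType d) (R : realType)
    (P : probability T R) (F : probability R R) (eps s : R) (n : nat)
    (Y : 'I_n -> {RV P >-> R}) (D : 'I_n -> {RV P >-> bool}) (A : set R) :
  mutually_independent P (fun i w => (Y i w, D i w)) ->
  (forall i, has_law (Y i) F) ->
  (forall i, has_law (D i) (bernoulli_prob eps)) ->
  measurable A -> 0 <= eps <= 1 -> 0 <= s <= 2^-1 ->
  (F A <= (2^-1 - eps - s)%:E)%E ->
  (P [set w | (n <=
      2 * #|hits (fun i => Y i @^-1` A `|` D i @^-1` [set true]) w|)%N] <=
   ((1 - 2 * s ^+ 2) ^+ n)%:E)%E.
Proof.
move=> hindep hY hD mA e01 s01 hA.
(* Each event is the preimage of one set [V] under the pair [(Y i, D i)], so independence across [i]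
   suffices, however the two coordinates are coupled. *)
pose V : set (R * bool) := (A `*` setT) `|` (setT `*` [set true]).
have mV : measurable V by apply: measurableU; exact: measurableX.
pose G i := Y i @^-1` A `|` D i @^-1` [set true].
have GE i : G i = (fun w => (Y i w, D i w)) @^-1` V.
  by apply/seteqP; split=> w /=; rewrite /G /V/=; tauto.
have mYA i : measurable (Y i @^-1` A) by exact: measurable_sfunP.
have mDt i : measurable (D i @^-1` [set true]) by exact: measurable_sfunP.
have := @hits_majority_prob _ T R P 'I_n G s; rewrite card_ord; apply => //.
- by move=> i; apply: measurableU.
- move=> J.
  have := hindep [set: 'I_n]%SET (fun i => if i \in J then V else ~` V).
  have -> : \bigcap_(i in [set` [set: 'I_n]%SET])
      (fun w => (Y i w, D i w)) @^-1` (if i \in J then V else ~` V) =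
      \bigcap_(i in [set: 'I_n]) (if i \in J then G i else ~` G i).
    apply/seteqP; split=> w h i _.
      by have /= := h i; rewrite inE GE => /(_ isT); case: ifP.
    by have /= := h i Logic.I; rewrite GE; case: ifP.
  move=> ->; last by move=> i _; case: ifP => // _; exact: measurableC.
  apply: eq_big => [i|i _]; first by rewrite inE.
  by rewrite GE; case: ifP.
(* The union bound gives [(2^-1 - eps - s) + eps = 2^-1 - s]. *)
- move=> i; apply: (@le_trans _ _
    (P (Y i @^-1` A) + P (D i @^-1` [set true]))%E); first exact: measureU2.
  have -> : P (Y i @^-1` A) = F A by exact: hY.
  have -> : P (D i @^-1` [set true]) = eps%:E.
    rewrite -[LHS]/(distribution P (D i) [set true]) hD//.
    rewrite bernoulli_probE// !diracE/=.
    by rewrite mem_set// memNset//= mule1 mule0 adde0.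
  by rewrite (le_trans (leeD2r _ hA))// -EFinD lee_fin; lra.
Qed.

(** Uses [1 - x <= expR (- x)] at [x = 2 * s ^+ 2]; the sample size makes the total exponent at
    least [4 * L], hence at least [L]. *)
Lemma pow_le_expR (R : realType) (s L : R) (n : nat) :
  0 < s -> s <= 2^-1 -> 0 <= L -> 2 * s ^- 2 * L <= n%:R ->
  (1 - 2 * s ^+ 2) ^+ n <= expR (- L).
Proof.
move=> s0 s1 L0 hn.
have s20 : 0 < s ^+ 2 by rewrite exprn_gt0.
have h1 : 0 <= 1 - 2 * s ^+ 2.
  suff : s ^+ 2 <= 2^-1 by lra.
  by rewrite expr2; nra.
apply: (@le_trans _ _ (expR (- (2 * s ^+ 2)) ^+ n)).
  by rewrite lerXn2r ?nnegrE ?expR_ge0// expR_ge1Dx.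
rewrite -expRM_natl ler_expR mulrN lerN2.
have : 2 * L <= s ^+ 2 * n%:R.
  rewrite -ler_pdivrMl//; apply: le_trans hn.
  by rewrite le_eqVlt; apply/orP; left; apply/eqP; ring.
by rewrite -mulrA [_ * n%:R]mulrC; nra.
Qed.

(** * Choice of the margin and union of the two tails *)

Theorem corollary13 (R : realType)
    (tbar B eps : R) (htbar : 0 < tbar < 2^-1) (hB : 0 < B)
    (heps : 0 < eps < tbar)
    (F : probability R R) (m1 m2 : R)
    (hm1 : is_median F m1) (hm2 : is_mad F m1 m2)
    (hF : median_family tbar B m2 F)
    (n : nat) (d : measure_display) (T : measurableType d)
    (P : probability T R)
    (Y : 'I_n -> {RV P >-> R}) (D : 'I_n -> {RV P >-> bool})
    (hindep : mutually_independent P (fun i w => (Y i w, D i w)))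
    (hY : forall i, has_law (Y i) F)
    (hD : forall i, has_law (D i) (bernoulli_prob eps))
    (Z : 'I_n -> {RV P >-> R})
    (delta E : R) (hdelta : 0 < delta < 1) (hE : 0 < E)
    (hn : 2 * Num.max (B ^+ 2 * m2 ^+ 2 / E ^+ 2) ((tbar - eps) ^- 2)
            * ln (3 / delta) <= n%:R) :
  ((1 - delta)%:E <=
   P [set w | `|empirical_median (fun i => contaminated Y D Z i w) - m1|
              <= B * m2 * eps + E]%R)%E.
Proof.
have /andP[tb0 tb1] := htbar; have /andP[e0 et] := heps.
have /andP[de0 de1] := hdelta.
have c0 : 0 <= B * m2 by rewrite mulr_ge0 ?(is_mad_ge0 hm2)// ltW.
set L := ln (3 / delta) in hn.
have L0 : 0 < L by rewrite ln_gt0// ltr_pdivlMr//; lra.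
(* [s] is the smaller of [tbar - eps] and [E / (B * m2)], matching the two arguments of the maximum
   in [hn]. When [B * m2 = 0] the first case applies, so no division by zero occurs. *)
have [s [s0 st sE sn]] : exists s, [/\ 0 < s, s <= tbar - eps,
    B * m2 * s <= E & 2 * s ^- 2 * L <= n%:R].
  have [h|h] := leP (B * m2 * (tbar - eps)) E.
    exists (tbar - eps); split=> //; first lra.
    apply: le_trans hn; rewrite ler_wpM2r ?(ltW L0)// ler_wpM2l//.
    by rewrite le_max lexx orbT.
  have cgt0 : 0 < B * m2.
    rewrite lt_neqAle c0 andbT eq_sym; apply/eqP => c00.
    by move: h; rewrite c00 mul0r; lra.
  exists (E / (B * m2)); split.
  - exact: divr_gt0.
  - by rewrite ler_pdivrMr// mulrC ltW.
  - by rewrite mulrC divfK// gt_eqF.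
  - apply: le_trans hn; rewrite ler_wpM2r ?(ltW L0)// ler_wpM2l//.
    by rewrite le_max expr_div_n invf_div exprMn lexx.
have n0 : (0 < n)%N.
  rewrite -(ltr0n R); apply: lt_le_trans sn.
  by rewrite mulr_gt0// mulr_gt0// invr_gt0 exprn_gt0.
have s12 : 0 <= s <= 2^-1 by lra.
have e01 : 0 <= eps <= 1 by lra.
have tail : (1 - 2 * s ^+ 2) ^+ n <= delta / 3.
  apply: (le_trans (pow_le_expR s0 _ (ltW L0) sn)); first lra.
  by rewrite expRN lnK ?invf_div// posrE divr_gt0.
set r := B * m2 * eps + E.
have r0 : 0 < r by rewrite /r ltr_wpDl// mulr_ge0// ltW.
have hr : B * m2 * (eps + s) <= r by rewrite mulrDr /r lerD2l.
pose bad A w :=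
  (n <= 2 * #|hits (fun i => Y i @^-1` A `|` D i @^-1` [set true]) w|)%N.
have mbad (A : set R) : measurable A -> measurable [set w | bad A w].
  move=> mA.
  apply: (@measurable_hits _ _ _ _
    [set J : {set 'I_n} | (n <= 2 * #|J|)%N]) => i.
  by apply: measurableU; exact: measurable_sfunP.
have Pbad (A : set R) : measurable A -> (F A <= (2^-1 - eps - s)%:E)%E ->
    (P [set w | bad A w] <= (delta / 3)%:E)%E.
  move=> mA FA.
  apply: (le_trans (contamination_tail hindep hY hD mA e01 s12 FA)).
  by rewrite lee_fin.
(* An index with [D i w] false has its observation equal to [Y i w], so every index whose
   observation satisfies [p] is a hit. *)
have card_bad A w (p : pred R) : (forall y, p y -> A y) -> ~~ bad A w ->
    (2 * #|[pred i | p (contaminated Y D Z i w)]| < n)%N.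
  move=> pA; rewrite -ltnNge; apply: leq_ltn_trans; rewrite leq_mul2l/=.
  apply: subset_leq_card; apply/fintype.subsetP => i; rewrite !inE => pi.
  have [Di|/negbTE Di] := boolP (D i w); [by right|left].
  by move: pi; rewrite /contaminated Di subr0 mul1r mul0r addr0; exact: pA.
pose U := `]m1 + r, +oo[%classic; pose W := `]-oo, (m1 - r)[%classic.
have mU : measurable U by exact: measurable_itv.
have mW : measurable W by exact: measurable_itv.
have FU : (F U <= (2^-1 - eps - s)%:E)%E.
  have := upper_tail_mass (t := m1 + r) htbar c0 hm1 hF e0 st.
  rewrite ltrDl r0 addrAC subrr add0r hr => /(_ isT isT) Fm.
  rewrite /U -setCitvl probability_setC// -law_cdfE -EFinB lee_fin; lra.
have FW : (F W <= (2^-1 - eps - s)%:E)%E.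
  have := lower_tail_mass (t := m1 - r) htbar c0 hm1 hF e0 st.
  rewrite ltrBlDr ltrDl r0 opprB addrCA subrr addr0 hr => /(_ isT isT) Fm.
  (* The open ray [W] is enlarged to the closed one, whose mass is the cdf. *)
  apply: (@le_trans _ _ (F `]-oo, (m1 - r)]%classic)).
    by rewrite le_measure ?inE// => y /=; rewrite !in_itv/=; exact: ltW.
  by rewrite -law_cdfE lee_fin.
have mUW : measurable ([set w | bad U w] `|` [set w | bad W w]).
  by apply: measurableU; exact: mbad.
(* Outside both bad events, of total probability at most [2 * delta / 3], the median lies within [r]
   of [m1]. *)
apply: (@le_trans _ _ (P (~` ([set w | bad U w] `|` [set w | bad W w])))).
  rewrite probability_setC//.
  have : (P ([set w | bad U w] `|` [set w | bad W w]) <= delta%:E)%E.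
    apply: (@le_trans _ _ (P [set w | bad U w] + P [set w | bad W w])%E).
      by apply: measureU2; exact: mbad.
    apply: (le_trans (leeD (Pbad U mU FU) (Pbad W mW FW))).
    rewrite -EFinD lee_fin; lra.
  rewrite -(@fineK _ (P (_ `|` _))) ?fin_num_measure//.
  rewrite -EFinB !lee_fin; lra.
apply: le_measure; rewrite ?inE; first exact: measurableC.
  (* Monotonicity of [P] requires the target event to be measurable: it is the preimage of a closed
     interval under the empirical median. *)
  rewrite (_ : [set w | _] =
      (fun w => empirical_median (fun i => contaminated Y D Z i w)) @^-1`
        `[m1 - r, m1 + r]%classic); last first.
    by apply/seteqP; split=> w /=; rewrite in_itv/= ler_distl.
  rewrite -[X in measurable X]setTI.
  apply: (measurable_empirical_median n0 (X := contaminated Y D Z)) => // i.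
  exact: measurable_contaminated.
move=> w /= /not_orP[/negP gU /negP gW].
rewrite ler_distl; apply/andP; split.
  by apply: empirical_median_ge; exact: (card_bad W w (fun x => x < m1 - r)).
apply: empirical_median_le; apply: (card_bad U w (fun x => m1 + r < x)) => // y.
by rewrite /U/= in_itv/= andbT.
Qed.
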